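(* Let $\Delta$ be a translation quiver and let $x,y \in \Delta_0$ be a pair of vertices such that all paths between $x$ and $y$ (i.e. from $x$ to $y$) are closed. If the paths between $x$ and $y$ are ordered mesh-lexicographically, there is a subset $\mathcal{S}(x,y) \subseteq \mathcal{R}(x,y)$ of the set $\mathcal{R}(x,y)$ of mesh-canonical relations between $x$ and $y$ satisfying: (1) for every pair of distinct relations $r,s \in \mathcal{S}(x,y)$, $\operatorname{lb}(r) \neq \operatorname{lb}(s)$; (2) for every relation $r \in \mathcal{R}(x,y) \setminus \mathcal{S}(x,y)$, $r$ is a linear combination of the relations in $\mathcal{S}(x,y)$. In particular, if $\mathcal{R}(x,y)_m$ denotes the set of mesh-canonical relations between $x$ and $y$ with fixed length $m \in \mathbb{N}$, then $\mathcal{R}(x,y)_m$ is a Gröbner basis.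
   Context: $k$ is an algebraically closed field. A translation quiver $\Delta$ is a quiver without loops (vertices $\Delta_0$, arrows $\Delta_1$), with a partially defined map $\tau$ on vertices (vertices outside the domain of $\tau$ are called projective, those outside its range injective) which is a bijection from non-projective to non-injective vertices, and, for all vertices $u,v$ with $u$ non-projective, a bijection $\sigma$ from arrows $v\to u$ to arrows $\tau u\to v$. All translation quivers are assumed locally finite: finitely many arrows start, and finitely many end, at each vertex. Paths are composed right to left; there is a trivial path $\epsilon_v$ of length $0$ at each vertex $v$. A vertex $u$ is a predecessor of $v$ if there is a path (possibly of length $0$) from $u$ to $v$; $v$ is an immediate successor of $u$ if there is an arrow $u\to v$. A path $x_0\to x_1\to\cdots\to x_m$ is closed if, whenever $0\le i\le m-2$ and $x_i=\tau x_{i+2}$, the vertex $x_i$ has at least two immediate successors; otherwise it is open. $k\Delta(x,y)$ is the $k$-vector space with basis the paths from $x$ to $y$. For a non-injective vertex $z$, $m_z=\sum_{\alpha}(\sigma^{-1}\alpha)\alpha$, the sum over all arrows $\alpha$ starting at $z$. A mesh-canonical relation between $x$ and $y$ is an element of $k\Delta(x,y)$ of the form $\gamma_2 m_z\gamma_1$, where $z$ is a non-injective vertex and $\gamma_1:x\rightsquigarrow z$, $\gamma_2:\tau^{-1}z\rightsquigarrow y$ are paths. Its length is the length of the paths of which it is a sum. Mesh-lexicographic orders. A path $\delta$ starts with a path $\gamma$ if $\delta=\gamma'\gamma$ for some path $\gamma'$. For each path $\gamma:x\rightsquigarrow z$ with $z$ a predecessor of $y$, fix a total order $<_\gamma$ on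 the set of arrows that start at $z$ and end at some predecessor of $y$. If $\delta,\delta':x\rightsquigarrow y$ are two distinct paths, there are a path $\gamma:x\rightsquigarrow z$ and distinct arrows $\alpha:z\to w$, $\alpha':z\to w'$, with $w$ and $w'$ predecessors of $y$, such that $\delta$ starts with $\alpha\gamma$ and $\delta'$ starts with $\alpha'\gamma$; these $\gamma,\alpha,\alpha'$ are uniquely determined, and one sets $\delta<\delta'\iff\alpha<_\gamma\alpha'$. This defines a total order $<$ on the paths from $x$ to $y$, and an order of this kind is called lexicographic. A total order $<$ on the paths from $x$ to $y$ is mesh-lexicographic if it is lexicographic and moreover: for every path $\gamma:x\rightsquigarrow z$ such that $\tau^{-1}z$ exists and is a predecessor of $y$, if $\alpha:z\to z'$ is the $<_\gamma$-largest among the arrows starting at $z$ and ending at a predecessor of $y$, then for every arrow $\beta:z'\to v$ with $v$ a predecessor of $y$ one has $\sigma^{-1}\alpha\le_{\alpha\gamma}\beta$. For nonzero $r\in k\Delta(x,y)$, $\operatorname{lb}(r)$ is the largest path (with respect to $<$) occurring in $r$ with nonzero coefficient. A finite set $G$ of nonzero vectors in a finite-dimensional vector space with a totally ordered basis is (or forms) a Gröbner basis if it is a Gröbner basis for the subspace it generates, i.e. for every nonzero $f$ in the span of $G$ there is $g\in G$ with $\operatorname{lb}(f)=\operatorname{lb}(g)$; here the ordered basis consists of the paths of length $m$ from $x$ to $y$. *)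

(* Defs.v *)
From HB Require Import structures.
From mathcomp Require Import all_boot all_order all_algebra.
From mathcomp Require Import finmap boolp classical_sets cardinality fsbigop.
From mathcomp.multinomials Require Import monalg.

Set Implicit Arguments.
Unset Strict Implicit.
Unset Printing Implicit Defensive.

Import GRing.Theory.
Local Open Scope classical_set_scope.
Local Open Scope ring_scope.

(* [tau v = None] means that [v] is projective, [tauV v = None] that [v] is
   injective; [tauP] says that [tau] is a bijection from the non-projective
   onto the non-injective vertices, with inverse [tauV].
   [sigma a] is meaningful only when the target of [a] is non-projective, and
   [sigmaV b] only when the source of [b] is non-injective; the axioms say that,
   for [tau u = Some t], [sigma] and [sigmaV] are inverse bijections between the
   arrows v -> u and the arrows t -> v. *)
Record translation_quiver := TranslationQuiver {
  vertex : choiceType;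
  arrow : choiceType;
  src : arrow -> vertex;
  tgt : arrow -> vertex;
  src_neq_tgt : forall a, src a != tgt a;
  tau : vertex -> option vertex;
  tauV : vertex -> option vertex;
  tauP : forall u t, tau u = Some t <-> tauV t = Some u;
  sigma : arrow -> arrow;
  sigmaV : arrow -> arrow;
  sigma_ends : forall a t, tau (tgt a) = Some t ->
    src (sigma a) = t /\ tgt (sigma a) = src a;
  sigmaV_ends : forall b u, tauV (src b) = Some u ->
    src (sigmaV b) = tgt b /\ tgt (sigmaV b) = u;
  sigmaK : forall a t, tau (tgt a) = Some t -> sigmaV (sigma a) = a;
  sigmaVK : forall b u, tauV (src b) = Some u -> sigma (sigmaV b) = b;
  finite_out : forall v, finite_set [set a | src a = v];
  finite_in : forall v, finite_set [set a | tgt a = v]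
}.

Section Paths.
Variable Q : translation_quiver.
Implicit Types (x y z u v w : vertex Q) (a b : arrow Q) (s : seq (arrow Q)).

(* Arrows are listed in the order in which they are traversed, so the product
   [g2 g1] of paths (composed right to left) is the list [g1 ++ g2]. *)
Fixpoint is_path x s y : bool :=
  if s is a :: s' then (src a == x) && is_path (tgt a) s' y else x == y.

Record qpath x y := QPath { arrows : seq (arrow Q); _ : is_path x arrows y }.

HB.instance Definition _ x y := [isSub for @arrows x y].
HB.instance Definition _ x y := [Choice of qpath x y by <:].

Lemma qpathP x y (p : qpath x y) : is_path x (arrows p) y.
Proof. exact: valP p. Qed.

Lemma is_path_cat x z y s1 s2 :
  is_path x s1 z -> is_path z s2 y -> is_path x (s1 ++ s2) y.
Proof.
elim: s1 x => [x /eqP->|a s1 IH x /= /andP[-> h1] h2] //=; exact: IH.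
Qed.

Definition qcomp x z y (q : qpath z y) (p : qpath x z) : qpath x y :=
  QPath (is_path_cat (qpathP p) (qpathP q)).

Definition predecessor u v : Prop := exists s, is_path u s v.

Definition immediate_succ u v : Prop := exists a, src a = u /\ tgt a = v.

Definition path_vertices x s : seq (vertex Q) := x :: map (@tgt Q) s.

Definition closed_path x y (p : qpath x y) : Prop :=
  let xs := nth x (path_vertices x (arrows p)) in
  forall i, (i.+2 <= size (arrows p))%N -> tau (xs i.+2) = Some (xs i) ->
  exists v w, [/\ v <> w, immediate_succ (xs i) v & immediate_succ (xs i) w].

Definition strict_total_on (T : Type) (D : set T) (lt : rel T) : Prop :=
  [/\ forall i, D i -> ~~ lt i i,
      forall i j l, D i -> D j -> D l -> lt i j -> lt j l -> lt i l
    & forall i j, D i -> D j -> i <> j -> lt i j \/ lt j i].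

Definition arrows_towards z y : set (arrow Q) :=
  [set a | src a = z /\ predecessor (tgt a) y].

(* The family [la] is indexed by lists of arrows; only its values at paths
   starting at [x] matter. The order is prescribed on every pair of paths which
   diverge after a common initial part; when [y] lies on an oriented cycle there
   are also pairs of which one is a proper initial part of the other (hence of
   different lengths), on which nothing is required. *)
Definition lexicographic_by x y (la : seq (arrow Q) -> rel (arrow Q))
    (lt : rel (qpath x y)) : Prop :=
  [/\ strict_total_on setT lt,
      forall s z, is_path x s z -> predecessor z y ->
        strict_total_on (arrows_towards z y) (la s)
    & forall (d d' : qpath x y) s a a', a <> a' ->
        prefix (rcons s a) (arrows d) -> prefix (rcons s a') (arrows d') ->
        lt d d' = la s a a'].

Definition largest_in (T : Type) (D : set T) (lt : rel T) (i : T) : Prop :=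
  D i /\ forall j, D j -> j <> i -> lt j i.

Definition mesh_lexicographic x y (lt : rel (qpath x y)) : Prop :=
  exists la, lexicographic_by la lt /\
    forall s z u, is_path x s z -> tauV z = Some u -> predecessor u y ->
    forall a, largest_in (arrows_towards z y) (la s) a ->
    forall b, arrows_towards (tgt a) y b ->
      sigmaV a = b \/ la (rcons s a) (sigmaV a) b.

Definition arrow_from z : Type := {a : arrow Q | src a == z}.

Lemma mesh_is_path z u (zu : tauV z = Some u) (a : arrow_from z) :
  is_path z [:: val a; sigmaV (val a)] u.
Proof.
case: a => a sa /=; have /sigmaV_ends[-> ->] : tauV (src a) = Some u by rewrite (eqP sa).
by rewrite sa !eqxx.
Qed.

Definition mesh_path z u (zu : tauV z = Some u) (a : arrow_from z) : qpath z u :=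
  QPath (mesh_is_path zu a).

End Paths.

Section PathSpaces.
Variables (k : closedFieldType) (Q : translation_quiver).
Implicit Types (x y z u w : vertex Q).

Definition kpath x y : lmodType k := {malg k[qpath x y]}.

Definition kcomp x z y (g : kpath z y) (f : kpath x z) : kpath x y :=
  \sum_(p <- msupp f) \sum_(q <- msupp g) (g@_q * f@_p) *: << qcomp q p >>.

Definition mesh z u (zu : tauV z = Some u) : kpath z u :=
  \sum_(a \in [set: arrow_from z]) (<< mesh_path zu a >> : kpath z u).

Definition mesh_relations x y : set (kpath x y) :=
  [set r | exists z u (zu : tauV z = Some u) (g1 : qpath x z) (g2 : qpath u y),
    r = kcomp << g2 >> (kcomp (mesh zu) << g1 >>)].

(* If no arrow starts at the non-injective vertex [z], then [mesh zu] is an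
   empty sum; the resulting relation 0 has no length. *)
Definition has_length x y (r : kpath x y) (m : nat) : Prop :=
  r != 0 /\ forall p, p \in msupp r -> size (arrows p) = m.

Definition mesh_relations_of_length x y (m : nat) : set (kpath x y) :=
  [set r | mesh_relations r /\ has_length r m].

Section Leading.
Variables (x y : vertex Q) (lt : rel (qpath x y)).

(* [lb r = None] exactly when [r = 0], if [lt] is a strict total order. *)
Definition lb (r : kpath x y) : option (qpath x y) :=
  ohead [seq p <- enum_fset (msupp r)
        | all (fun q => (q == p) || lt q p) (enum_fset (msupp r))].

Definition linear_combination (G : set (kpath x y)) (f : kpath x y) : Prop :=
  exists n (c : 'I_n -> k) (g : 'I_n -> kpath x y),
    (forall i, G (g i)) /\ f = \sum_i c i *: g i.

Definition groebner_basis (G : set (kpath x y)) : Prop :=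
  [/\ finite_set G,
      forall g, G g -> g != 0
    & forall f, linear_combination G f -> f != 0 ->
        exists2 g, G g & lb f = lb g].

End Leading.
End PathSpaces.

(* Main.v *)
(* List the relation [g2 m_z g1] by the path pair (g1, g2); its leading path is
   [g2 (sigma^-1 a) a g1] with [a] the largest arrow at [z] after [g1]. Suppose
   two relations have the same leading path. If the two meshes overlap in one
   arrow [b], mesh-lexicographicity makes [b] both the least and the largest
   continuation, hence the only arrow leaving its source, contradicting
   closedness. Otherwise the meshes are disjoint, and expanding the product
   containing both meshes in two ways shows that the difference of the two
   relations is a combination of relations with smaller leading paths. So one
   relation for each leading path spans all relations, by induction on the
   finitely many paths of a given length. *)
Require Import Defs.
From mathcomp Require Import all_boot all_order all_algebra.
From mathcomp Require Import finmap boolp classical_sets cardinality fsbigop.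
From mathcomp.multinomials Require Import monalg.

Set Implicit Arguments.
Unset Strict Implicit.
Unset Printing Implicit Defensive.

Import GRing.Theory.
Local Open Scope classical_set_scope.
Local Open Scope ring_scope.

(** * Linear extension of maps given on a basis *)

Section LinearExtension.
Variables (k : fieldType) (K : choiceType) (V : lmodType k) (F : K -> V).
Implicit Types f g : {malg k[K]}.

(** The linear map that takes the value [F q] on the basis vector [q]. Composition with a fixed
    path, on either side, is a map of this kind. *)
Definition lift_basis g : V := \sum_(q <- msupp g) g@_q *: F q.

Lemma lift_basis_sub g (D : {fset K}) : (msupp g `<=` D)%fset ->
  lift_basis g = \sum_(q <- D) g@_q *: F q.
Proof.
move=> sgD; apply: big_fset_incl => // q _ /mcoeff_outdom ->.
exact: scale0r.
Qed.

Lemma lift_basisD f g : lift_basis (f + g) = lift_basis f + lift_basis g.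
Proof.
pose D := (msupp f `|` msupp g)%fset.
rewrite (@lift_basis_sub _ D) ?msuppD_le//.
rewrite (@lift_basis_sub f D) ?fsubsetUl// (@lift_basis_sub g D) ?fsubsetUr//.
by rewrite -big_split; apply: eq_bigr => q _; rewrite mcoeffD scalerDl.
Qed.

Lemma lift_basisU q : lift_basis << q >> = F q.
Proof.
by rewrite /lift_basis msuppU oner_eq0 big_seq_fset1 mcoeffUU scale1r.
Qed.

Lemma lift_basis_sum (I : Type) (L : seq I) (h : I -> K) :
  lift_basis (\sum_(i <- L) << h i >>) = \sum_(i <- L) F (h i).
Proof.
have E0 : lift_basis 0 = 0 by rewrite /lift_basis msupp0 big_seq_fset0.
rewrite (big_morph _ lift_basisD E0); apply: eq_bigr => i _.
exact: lift_basisU.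
Qed.

End LinearExtension.

(** * Enumeration of the paths of a given length, and their vertices *)

Section FinitePaths.
Variable Q : translation_quiver.
Implicit Types (x y z u : vertex Q) (a b : arrow Q) (s t : seq (arrow Q)).

Definition out z : seq (arrow Q) := fset_set [set a | src a = z].

Lemma mem_out z a : (a \in out z) = (src a == z).
Proof.
rewrite /out; have /= -> := in_fset_set (finite_out z) a.
by apply/idP/eqP => [/set_mem|/mem_set].
Qed.

Lemma out_uniq z : uniq (out z).
Proof. exact: fset_uniq. Qed.

Fixpoint paths_from m x : seq (seq (arrow Q)) :=
  if m is m'.+1 then
    flatten [seq [seq a :: s | s <- paths_from m' (tgt a)] | a <- out x]
  else [:: [::]].

Lemma mem_paths_from x s y : is_path x s y -> s \in paths_from (size s) x.
Proof.
elim: s x => [//|a s IH] x /= /andP[/eqP <- /IH sP].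
apply/flatten_mapP; exists a; first by rewrite mem_out.
exact: map_f.
Qed.

Definition paths_between m x y : seq (qpath x y) :=
  pmap insub (paths_from m x).

Lemma mem_paths_between x y (p : qpath x y) :
  p \in paths_between (size (arrows p)) x y.
Proof.
by rewrite mem_pmap_sub; apply: mem_paths_from (qpathP p).
Qed.

Lemma is_path_catP x s t y :
  is_path x (s ++ t) y -> exists2 z, is_path x s z & is_path z t y.
Proof.
elim: s x => [|a s IH] x /=; first by exists x.
by move=> /andP[-> /IH[z sz tz]]; exists z; rewrite ?sz.
Qed.

Lemma nth_path_vertices x s z t :
  is_path x s z -> nth x (path_vertices x (s ++ t)) (size s) = z.
Proof.
move=> sz; rewrite -[RHS](_ : last x (map (@tgt Q) s) = z); last first.
  by elim: s x sz => [|a s IH] x /=; [move/eqP|case/andP=> _ /IH].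
(* The default value of [nth] and the first vertex are generalised separately: only the latter moves
   along the path. *)
by elim: s (x) {2 3}x {sz} => [|a s IH] x' x0 //=; exact: IH.
Qed.

End FinitePaths.

(** * Mesh-canonical relations written on lists of arrows *)

Section MeshRelations.
Variables (k : closedFieldType) (Q : translation_quiver).
Variables (x y : vertex Q).
Implicit Types (z u : vertex Q) (a b : arrow Q) (s t : seq (arrow Q)).
Implicit Types (p q : qpath x y) (r f : kpath k x y).

(** Lists that are not paths from [x] to [y] are sent to 0, so that sums of paths can be written
    with bare lists, without proofs about endpoints inside the terms. *)
Definition pathv s : kpath k x y :=
  if insub s is Some p then << (p : qpath x y) >> else 0.

Lemma pathvE p : pathv (arrows p) = << p >>.
Proof. by rewrite /pathv (valK p). Qed.

Lemma mcoeff_pathv s p : (pathv s)@_p = (s == arrows p)%:R.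
Proof.
rewrite /pathv; case: insubP => [q _ <-|sN].
  by rewrite mcoeffU -val_eqE.
rewrite mcoeff0; case: eqP => // sp.
by rewrite sp qpathP in sN.
Qed.

Definition mesh_rel s z t : kpath k x y :=
  \sum_(a <- out z) pathv (s ++ [:: a, sigmaV a & t]).

(** Distinct arrows of [out z] give distinct lists. Hence no two terms collide, and each coefficient
    is 0 or 1 whatever the characteristic of [k]. *)
Lemma mcoeff_mesh_rel s z t p :
  (mesh_rel s z t)@_p = 
  (has (fun a => s ++ [:: a, sigmaV a & t] == arrows p) (out z))%:R.
Proof.
rewrite /mesh_rel raddf_sum /=.
elim: (out z) (out_uniq z) => [|a o IH] /=; first by rewrite big_nil.
case/andP=> ao /IH {}IH; rewrite big_cons mcoeff_pathv {}IH.
case: eqP => //= [sp|_]; last by rewrite add0r.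
case: hasP => [[b bo /eqP]|]; last by rewrite addr0.
rewrite -sp => /eqP; rewrite eqseq_cat// eqxx /= => /eqP[ba _].
by rewrite -ba bo in ao.
Qed.

Lemma supp_mesh_relP s z t p : reflect
  (exists2 a, src a = z & arrows p = s ++ [:: a, sigmaV a & t])
  (p \in msupp (mesh_rel s z t)).
Proof.
rewrite -mcoeff_neq0 mcoeff_mesh_rel.
have -> (b : bool) : (b%:R != 0 :> k) = b by case: b; rewrite ?oner_neq0 ?eqxx.
apply: (iffP hasP) => [[a]|[a az ->]].
  by rewrite mem_out => /eqP az /eqP <-; exists a.
by exists a; rewrite ?mem_out ?az ?eqxx.
Qed.

Lemma mesh_relationsP r : mesh_relations r <-> exists s z u t,
  [/\ is_path x s z, tauV z = Some u, is_path u t y & r = mesh_rel s z t].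
Proof.
have composite z u (zu : tauV z = Some u) (g1 : qpath x z) (g2 : qpath u y) :
    kcomp << g2 >> (kcomp (mesh k zu) << g1 >>) =
    mesh_rel (arrows g1) z (arrows g2).
  (* Local finiteness is essential here: over an infinite support the sum defining [mesh] would take
     the default value 0. *)
  have Tfin : finite_set [set: arrow_from z].
    apply: (@sub_finite_set _ _ [set` pmap insub (out z) : seq (arrow_from z)]).
      by move=> [a az] _ /=; rewrite mem_pmap_sub /= mem_out.
    exact: finite_seq.
  have meshE : mesh k zu =
      \sum_(a <- fset_set [set: arrow_from z]) << mesh_path zu a >>.
    apply: fsbigTE => a; rewrite in_fset_set// => /negP[].
    by rewrite in_setT.
  have kcompr w (g : kpath k z w) : kcomp g << g1 >> =
      lift_basis (fun q : qpath z w => << qcomp q g1 >> : kpath k x w) g.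
    rewrite /kcomp msuppU oner_eq0 big_seq_fset1 mcoeffUU.
    by apply: eq_bigr => q _; rewrite mulr1.
  have kcompl (g : kpath k x u) : kcomp << g2 >> g =
      lift_basis (fun q : qpath x u => << qcomp g2 q >> : kpath k x y) g.
    rewrite /kcomp; apply: eq_bigr => p _.
    by rewrite msuppU oner_eq0 big_seq_fset1 mcoeffUU mul1r.
  rewrite kcompr meshE lift_basis_sum kcompl lift_basis_sum.
  pose L : seq (arrow_from z) := fset_set [set: arrow_from z].
  rewrite /mesh_rel (perm_big [seq sval e | e <- L]) /=.
    rewrite big_map; apply: eq_bigr => a _.
    by rewrite -pathvE /= -catA.
  rewrite perm_sym; apply: uniq_perm (out_uniq z) _ => [|a].
    by rewrite map_inj_uniq ?fset_uniq//; exact: val_inj.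
  rewrite mem_out; apply/mapP/idP => [[[b bz] _ ->]//|az].
  exists (exist _ a az) => //; rewrite /L.
  by have /= -> := in_fset_set Tfin (exist _ a az); rewrite in_setT.
split=> [[z [u [zu [g1 [g2 ->]]]]]|[s [z [u [t [sz zu ut ->]]]]]].
  exists (arrows g1), z, u, (arrows g2); split; [exact: qpathP|by []|exact: qpathP|].
  exact: composite.
by exists z, u, zu, (QPath sz), (QPath ut); rewrite composite.
Qed.

End MeshRelations.

(** * Closure properties of linear combinations *)

Section LinearCombinations.
Variables (k : fieldType) (V : lmodType k).
Implicit Types (f g : V) (G H : set V).

(* On [kpath x y] this is convertible to [linear_combination]. *)
Definition lincomb G f : Prop :=
  exists n (c : 'I_n -> k) (g : 'I_n -> V),
    (forall i, G (g i)) /\ f = \sum_i c i *: g i.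

Lemma lincomb_mem G g : G g -> lincomb G g.
Proof.
move=> Gg; exists 1%N, (fun=> 1), (fun=> g); split=> //.
by rewrite big_ord1 scale1r.
Qed.

Lemma lincomb0 G : lincomb G 0.
Proof.
by exists 0%N, (fun=> 0), (fun=> 0); split=> [[]//|]; rewrite big_ord0.
Qed.

Lemma lincombD G f g :
  lincomb G f -> lincomb G g ->
  lincomb G (f + g).
Proof.
move=> [n [c [h [Gh ->]]]] [n' [c' [h' [Gh' ->]]]].
exists (n + n')%N, (fun i => match split i with inl j => c j | inr j => c' j end),
  (fun i => match split i with inl j => h j | inr j => h' j end).
split=> [i|]; first by case: (split i).
have splitl i : split (lshift n' i) = inl i := unsplitK (inl i).
have splitr i : split (rshift n i) = inr i := unsplitK (inr i).
rewrite big_split_ord; congr (_ + _); apply: eq_bigr => i _.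
  by rewrite splitl.
by rewrite splitr.
Qed.

Lemma lincombZ G (c : k) f :
  lincomb G f -> lincomb G (c *: f).
Proof.
move=> [n [d [h [Gh ->]]]]; exists n, (fun i => c * d i), h; split=> //.
by rewrite scaler_sumr; apply: eq_bigr => i _; rewrite scalerA.
Qed.

Lemma lincombB G f g :
  lincomb G f -> lincomb G g ->
  lincomb G (f - g).
Proof.
by move=> lf lg; rewrite -scaleN1r; apply/lincombD/lincombZ.
Qed.

Lemma lincomb_sum G (I : eqType) (L : seq I) (P : pred I)
    (h : I -> V) :
  (forall i, i \in L -> P i -> lincomb G (h i)) ->
  lincomb G (\sum_(i <- L | P i) h i).
Proof.
move=> lh; rewrite big_seq_cond.
apply: big_ind => [||i /andP[]]; [exact: lincomb0| |exact: lh].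
exact: lincombD.
Qed.

Lemma lincomb_trans G H f :
  (forall g, G g -> lincomb H g) ->
  lincomb G f -> lincomb H f.
Proof.
move=> GH [n [c [h [Gh ->]]]]; apply: lincomb_sum => i _ _.
exact/lincombZ/GH.
Qed.

(** Coefficients of repeated vectors are added up and vanishing totals dropped, so that leading
    terms cannot cancel between copies of one vector. *)
Lemma lincomb_uniq G f : lincomb G f ->
  exists (L : seq (V)) (c : V -> k),
    [/\ uniq L, {in L, forall g, G g /\ c g != 0} & f = \sum_(g <- L) c g *: g].
Proof.
move=> [n [c [h [Gh ->]]]].
pose L := undup (codom h); pose d g := \sum_(i | h i == g) c i.
exists [seq g <- L | d g != 0], d; split.
- exact/filter_uniq/undup_uniq.
- move=> g; rewrite mem_filter mem_undup => /andP[dg /codomP[i gi]].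
  by split; first by rewrite gi; exact: Gh.
- rewrite big_filter [RHS]big_mkcond /=.
  (* Each index [i] contributes to the single [g] equal to [h i], so exchanging the sums regroups
     the combination by vectors. *)
  transitivity (\sum_(g <- L) \sum_(i < n | h i == g) c i *: h i).
    rewrite (exchange_big_dep xpredT)//=; apply: eq_bigr => i _.
    rewrite -big_filter (_ : filter _ _ = [:: h i]) ?big_seq1//.
    rewrite (@eq_filter _ _ (pred1 (h i))) => [|g]; last exact: eq_sym.
    by rewrite filter_pred1_uniq ?undup_uniq// mem_undup; exact: codom_f.
  apply: eq_bigr => g _; rewrite (eq_bigr (fun i => c i *: g)) => [|i /eqP->//].
  rewrite -scaler_suml -/(d g); case: eqP => //= ->.
  exact: scale0r.
Qed.

End LinearCombinations.

(** * Leading paths and their behaviour in linear combinations *)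

Section LeadingPaths.
Variables (k : closedFieldType) (Q : translation_quiver) (x y : vertex Q).
Variable lt : rel (qpath x y).
Hypothesis ltT : strict_total_on setT lt.
Implicit Types (p q : qpath x y) (r f g : kpath k x y).

Let lt_irr p : lt p p = false.
Proof. by have [irr _ _] := ltT; exact/negbTE/irr. Qed.

Let lt_trans p q o : lt p q -> lt q o -> lt p o.
Proof. by have [_ tr _] := ltT; exact: tr. Qed.

Lemma seq_has_largest (s : seq (qpath x y)) : s != [::] ->
  exists2 p, p \in s & {in s, forall q, q = p \/ lt q p}.
Proof.
elim: s => [//|p s IH] _; have [->|/IH[q qs qmax]] := eqVneq s [::].
  by exists p; rewrite ?mem_head// => q; rewrite inE => /eqP; left.
have [pq|pq] := pselect (q = p \/ lt q p).
  exists p; first exact: mem_head.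
  move=> o; rewrite inE => /predU1P[|/qmax]; first by left.
  case: pq => [->//|qp [->|oq]]; right=> //; exact: lt_trans qp.
exists q; first by rewrite inE qs orbT.
move=> o; rewrite inE => /predU1P[->|/qmax//].
have [_ _ tot] := ltT; have [->|pNq] := pselect (p = q); first by left.
by have [|qp] := tot p q I I pNq; [right|case: pq; right].
Qed.

Definition lead r p : Prop :=
  p \in msupp r /\ {in msupp r, forall q, q = p \/ lt q p}.

Lemma lead_fun r p q : lead r p -> lead r q -> p = q.
Proof.
move=> [pr pmax] [qr qmax]; have [->//|pq] := qmax _ pr.
have [->//|qp] := pmax _ qr.
by have := lt_trans pq qp; rewrite lt_irr.
Qed.

Lemma lead_exists r : r != 0 -> exists p, lead r p.
Proof.
move=> r0; have [|p pr pmax] := @seq_has_largest (msupp r : seq _); last by exists p.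
apply: contra_neq r0 => E; apply/malgP => p; rewrite mcoeff0.
apply: mcoeff_outdom; have -> : (p \in msupp r) = (p \in enum_fset (msupp r)) by [].
by rewrite E.
Qed.

Lemma lbP r p : lb lt r = Some p <-> lead r p.
Proof.
have lb_lead q : lb lt r = Some q -> lead r q.
  rewrite /lb; case E : [seq _ <- _ | _] => [//|o l] /= [<-].
  have : o \in o :: l by exact: mem_head.
  rewrite -E mem_filter => /andP[/allP omax or]; split=> // q' /omax.
  by case/predU1P; [left|right].
split=> [|pr]; first exact: lb_lead.
case E : (lb lt r) => [q|]; first by rewrite (lead_fun (lb_lead _ E) pr).
move: E; rewrite /lb; case E : [seq _ <- _ | _] => [|//] _.
have : p \in [::] by rewrite -E mem_filter pr.1 andbT; apply/allP => q /pr.2;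
  case=> [->|->]; rewrite ?eqxx ?orbT.
by [].
Qed.

(** Among the generators that really occur, take the one with the largest leading path [p]. Leading
    paths being distinct, [p] lies in the support of no other generator, so it survives in [f];
    every other path of [f] is smaller. *)
Lemma lead_linear_combination (G : set (kpath k x y)) f :
  (forall g, G g -> g != 0) ->
  (forall g h, G g -> G h -> g <> h -> lb lt g <> lb lt h) ->
  lincomb G f -> f != 0 ->
  exists2 g, G g & lb lt f = lb lt g.
Proof.
move=> G0 Ginj /lincomb_uniq[L [c [Lu LG ->]]] f0.
have [|p] := @seq_has_largest (pmap (lb lt) L).
  case: L f0 {Lu} LG => [|g L]; first by rewrite big_nil eqxx.
  move=> _ LG /=; have [Gg _] := LG g (mem_head _ _).
  by have [p /lbP->] := lead_exists (G0 _ Gg).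
rewrite mem_pmap => /mapP[g gL /esym gp] pmax.
have [Gg cg] := LG g gL; exists g => //; rewrite gp; apply/lbP.
(* A path of a generator is bounded by the leading path of that generator, which in turn is bounded
   by [p]. *)
have below h q : h \in L -> q \in msupp h ->
    exists2 o, lead h o & (q = o \/ lt q o) /\ (o = p \/ lt o p).
  move=> hL qh; have [o ho] := lead_exists (G0 _ (LG h hL).1).
  exists o => //; split; first exact: ho.2.
  by apply: pmax; rewrite mem_pmap; apply/mapP; exists h => //; apply/esym/lbP.
split.
  rewrite -mcoeff_neq0 raddf_sum /= (bigD1_seq g)//= big_seq_cond big1.
    rewrite addr0 mcoeffZ mulf_neq0// mcoeff_neq0.
    by have /lbP[] := gp.
  move=> h /andP[hL hg]; rewrite mcoeffZ; case: (msuppP h p) => [ph|_]; last exact: mulr0.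
  have [o ho [po op]] := below h p hL ph.
  (* As [p] is at most [o] and [o] at most [p], the generator [h] also leads with [p], against the
     distinctness of leading paths. *)
  have {po op} op : o = p.
    case: op => // op; case: po => [//|po].
    by have := lt_trans po op; rewrite lt_irr.
  case: (Ginj h g) => //; first exact: (LG h hL).1.
    by move=> E; rewrite E eqxx in hg.
  by rewrite gp; apply/lbP; rewrite -op.
move=> q; rewrite -mcoeff_neq0 raddf_sum /= => qf.
have [h hL qh] : exists2 h, h \in L & q \in msupp h.
  apply/hasP; apply: contraNT qf => /hasPn L0; rewrite big_seq big1// => h /L0.
  by rewrite mcoeffZ => /mcoeff_outdom ->; rewrite mulr0.
have [o ho [qo op]] := below h q hL qh.
case: qo => [->//|qo]; right; case: op => [<-//|op].
exact: lt_trans op.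
Qed.

End LeadingPaths.

(** * Pairs of relations with the same leading path *)

Section MeshLexicographic.
Variables (k : closedFieldType) (Q : translation_quiver) (x y : vertex Q).
Variables (lt : rel (qpath x y)) (la : seq (arrow Q) -> rel (arrow Q)).
Hypothesis laT : lexicographic_by la lt.
Implicit Types (z u : vertex Q) (a b : arrow Q) (s t w : seq (arrow Q)).
Implicit Types (p q : qpath x y) (r f : kpath k x y).

Let ltT : strict_total_on setT lt. Proof. by case: laT. Qed.

Lemma lt_diverge p q s a b t w : a <> b ->
  arrows p = s ++ a :: t -> arrows q = s ++ b :: w -> lt p q = la s a b.
Proof.
have [_ _ lex] := laT; move=> ab pE qE; apply: lex => //.
  by rewrite pE -cat_rcons prefix_prefix.
by rewrite qE -cat_rcons prefix_prefix.
Qed.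

Definition mesh_data s z u t : Prop :=
  [/\ is_path x s z, tauV z = Some u & is_path u t y].

Lemma mesh_through s z u t a : mesh_data s z u t -> src a = z ->
  is_path x (s ++ [:: a, sigmaV a & t]) y.
Proof.
move=> [sz zu ut] az; apply: is_path_cat sz _ => /=.
have [-> ->] : src (sigmaV a) = tgt a /\ tgt (sigmaV a) = u.
  by apply: sigmaV_ends; rewrite az.
by rewrite az !eqxx.
Qed.

Lemma arrow_towards s z u t a : mesh_data s z u t -> src a = z ->
  arrows_towards z y a.
Proof.
move=> [_ zu ut] az; split=> //; exists (sigmaV a :: t) => /=.
have [-> ->] : src (sigmaV a) = tgt a /\ tgt (sigmaV a) = u.
  by apply: sigmaV_ends; rewrite az.
by rewrite eqxx.
Qed.

(** Two paths of one relation diverge right after [s], so they compare as their arrows at [z] do.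
    Since [u] precedes [y], all arrows starting at [z] take part in this comparison. *)
Lemma lead_mesh_rel s z u t p : mesh_data s z u t ->
    lead lt (mesh_rel k x y s z t) p ->
  exists a, [/\ src a = z, arrows p = s ++ [:: a, sigmaV a & t]
    & forall b, src b = z -> b <> a -> la s b a].
Proof.
move=> szut [/supp_mesh_relP[a az pE] pmax]; exists a; split=> // b bz ba.
pose q : qpath x y := QPath (mesh_through szut bz).
rewrite -(@lt_diverge q p s b a (sigmaV b :: t) (sigmaV a :: t))//.
have [|qp|//] := pmax q; first by apply/supp_mesh_relP; exists b.
have /eqP : arrows q = arrows p by rewrite qp.
by rewrite pE eqseq_cat// eqxx => /eqP[/ba].
Qed.

(** The condition on lengths keeps the later induction inside the finitely many paths of one
    length. *)
Definition relations_below p : set (kpath k x y) :=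
  [set r | mesh_relations r /\
    forall q, q \in msupp r -> size (arrows q) = size (arrows p) /\ lt q p].

(* The two relations are the reductions of a double sum over the pairs of
   arrows [a'], [b'] with sources [z], [z'], from which they are obtained by
   fixing [b' = b], respectively [a' = a]. The remaining terms are relations,
   all of whose paths leave [p] downwards at the first or the second mesh. *)
Lemma disjoint_overlap s z u w z' u' t a b p :
  is_path x s z -> tauV z = Some u -> is_path u w z' -> tauV z' = Some u' ->
  is_path u' t y -> src a = z -> src b = z' ->
  arrows p = s ++ [:: a, sigmaV a & w ++ [:: b, sigmaV b & t]] ->
  (forall c, src c = z -> c <> a -> la s c a) ->
  (forall c, src c = z' -> c <> b -> la (s ++ [:: a, sigmaV a & w]) c b) ->
  lincomb (relations_below p)
    (mesh_rel k x y s z (w ++ [:: b, sigmaV b & t]) -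
     mesh_rel k x y (s ++ [:: a, sigmaV a & w]) z' t).
Proof.
move=> sz zu uw zu' ut az bz pE amax bmax.
have data1 c : src c = z' -> mesh_data s z u (w ++ [:: c, sigmaV c & t]).
  move=> cz; split=> //; apply: is_path_cat uw _ => /=.
  have [-> ->] : src (sigmaV c) = tgt c /\ tgt (sigmaV c) = u'.
    by apply: sigmaV_ends; rewrite cz.
  by rewrite cz !eqxx.
have data2 c : src c = z -> mesh_data (s ++ [:: c, sigmaV c & w]) z' u' t.
  move=> cz; split=> //; apply: is_path_cat sz _ => /=.
  have [-> ->] : src (sigmaV c) = tgt c /\ tgt (sigmaV c) = u.
    by apply: sigmaV_ends; rewrite cz.
  by rewrite cz !eqxx.
have relP s0 z0 u0 t0 : mesh_data s0 z0 u0 t0 ->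
    mesh_relations (mesh_rel k x y s0 z0 t0).
  by case=> *; apply/mesh_relationsP; exists s0, z0, u0, t0.
have dbl : \sum_(c <- out z') mesh_rel k x y s z (w ++ [:: c, sigmaV c & t]) =
    \sum_(c <- out z) mesh_rel k x y (s ++ [:: c, sigmaV c & w]) z' t.
  rewrite /mesh_rel exchange_big /=; apply: eq_bigr => c _.
  by apply: eq_bigr => d _; rewrite -catA.
have subE (V : zmodType) (e1 e2 f1 f2 : V) : e1 + f1 = e2 + f2 -> e1 - e2 = f2 - f1.
  by move=> E; rewrite -[e1](addrK f1) E addrAC [e2 + f2]addrC addrK.
have /subE-> : mesh_rel k x y s z (w ++ [:: b, sigmaV b & t]) +
    \sum_(c <- out z' | c != b) mesh_rel k x y s z (w ++ [:: c, sigmaV c & t]) =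
    mesh_rel k x y (s ++ [:: a, sigmaV a & w]) z' t +
    \sum_(c <- out z | c != a) mesh_rel k x y (s ++ [:: c, sigmaV c & w]) z' t.
  rewrite -(bigD1_seq b (F := fun c =>
    mesh_rel k x y s z (w ++ [:: c, sigmaV c & t])))//= ?mem_out ?bz ?out_uniq//.
  rewrite -(bigD1_seq a (F := fun c =>
    mesh_rel k x y (s ++ [:: c, sigmaV c & w]) z' t))//= ?mem_out ?az ?out_uniq//.
apply: lincombB; apply: lincomb_sum => c;
  rewrite mem_out => /eqP cz /eqP cN; apply: lincomb_mem; split.
- exact/relP/data2.
- move=> q /supp_mesh_relP[d dz qE]; split.
    by rewrite pE qE !size_cat /= !size_cat /= !addnS !addSn addnA.
  rewrite (@lt_diverge q p s c a (sigmaV c :: w ++ [:: d, sigmaV d & t])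
    (sigmaV a :: w ++ [:: b, sigmaV b & t]))//; first exact: amax.
  by rewrite qE -catA.
- exact/relP/data1.
- move=> q /supp_mesh_relP[d dz qE]; split.
    by rewrite pE qE !size_cat /= !size_cat.
  (* If the first mesh is crossed through [a], the path drops below [p] at the second mesh, since
     [c] is not [b]; otherwise it does so at the first. *)
  have [da|da] := pselect (d = a).
    rewrite (@lt_diverge q p (s ++ [:: a, sigmaV a & w]) c b (sigmaV c :: t)
      (sigmaV b :: t))//; first exact: bmax.
      by rewrite qE da -catA.
    by rewrite pE -catA.
  rewrite (@lt_diverge q p s d a (sigmaV d :: w ++ [:: c, sigmaV c & t])
    (sigmaV a :: w ++ [:: b, sigmaV b & t]))//; exact: amax.
Qed.

Hypothesis closedQ : forall p : qpath x y, closed_path p.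
Hypothesis laM : forall s z u, is_path x s z -> tauV z = Some u ->
  predecessor u y -> forall a, largest_in (arrows_towards z y) (la s) a ->
  forall b, arrows_towards (tgt a) y b ->
    sigmaV a = b \/ la (rcons s a) (sigmaV a) b.

(** Excludes two meshes sharing the arrow [sigmaV a]: this would be the only arrow starting at
    [tgt a], while closedness of [p] demands two successors of that vertex. *)
Lemma no_adjacent_overlap s z u t p a :
  is_path x s z -> tauV z = Some u -> src a = z ->
  arrows p = s ++ [:: a, sigmaV a, sigmaV (sigmaV a) & t] ->
  (forall c, src c = z -> c <> a -> la s c a) ->
  forall u', tauV (tgt a) = Some u' -> is_path u' t y ->
  ~ (forall c, src c = tgt a -> c <> sigmaV a -> la (rcons s a) c (sigmaV a)).
Proof.
move=> sz zu az pE amax u' zu' ut bmax; set b := sigmaV a in pE bmax.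
have [bz bu] : src b = tgt a /\ tgt b = u by apply: sigmaV_ends; rewrite az.
have saz : is_path x (rcons s a) (tgt a).
  by rewrite -cats1; apply: is_path_cat sz _; rewrite /= az !eqxx.
have data2 : mesh_data (rcons s a) (tgt a) u' t by [].
have [cu cu'] : src (sigmaV b) = tgt b /\ tgt (sigmaV b) = u'.
  by apply: sigmaV_ends; rewrite bz.
have data1 : mesh_data s z u (sigmaV b :: t).
  by split=> //=; rewrite cu cu' bu eqxx.
(* Every arrow starting at [tgt a] ends at a predecessor of [y], because [u'] is one. So the order
   compares all of them: [laM] makes [b] the least and [bmax] the largest. *)
have only c : src c = tgt a -> c = b.
  move=> cz; have [//|cb] := pselect (c = b); exfalso.
  have tow d := @arrow_towards _ _ _ _ d data2.
  have alarge : largest_in (arrows_towards z y) (la s) a.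
    split=> [|d [dz _] /(amax d dz)//]; exact: arrow_towards data1 az.
  have upred : predecessor u y by exists (sigmaV b :: t); case: data1.
  have [bc|bc] := laM sz zu upred alarge (tow c cz); first exact/cb/esym.
  have [_ /(_ _ _ saz) strict _] := laT.
  have [|irr tr _] := strict.
    by exists (sigmaV a :: sigmaV b :: t); rewrite /= -/b bz eqxx cu cu' eqxx.
  have := irr b (tow b bz); rewrite (tr b c b) //; first exact: tow.
  - exact: tow.
  - exact: tow.
  - exact: bmax.
(* This index is the position of [tgt a] on [p]; two steps later comes [u'], and [tgt a] is its
   translate. Closedness then gives two distinct successors, hence two distinct arrows. *)
have [] := @closedQ p (size (rcons s a)).
- by rewrite pE size_cat size_rcons /= !addnS !ltnS leq_addr.
- have -> : arrows p = rcons s a ++ [:: b, sigmaV b & t] by rewrite pE cat_rcons.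
  rewrite (nth_path_vertices _ saz).
  have -> : rcons s a ++ [:: b, sigmaV b & t] = (rcons s a ++ [:: b; sigmaV b]) ++ t.
    by rewrite -catA.
  have -> : (size (rcons s a)).+2 = size (rcons s a ++ [:: b; sigmaV b]).
    by rewrite size_cat addn2.
  rewrite (@nth_path_vertices _ _ _ u'); first exact/tauP.
  by apply: is_path_cat saz _; rewrite /= bz cu cu' !eqxx.
- move=> v [v' [vv' [c [cz cv]] [c' [cz' cv']]]]; apply: vv'.
  move: cz cz'; have -> : arrows p = rcons s a ++ [:: b, sigmaV b & t].
    by rewrite pE cat_rcons.
  by rewrite (nth_path_vertices _ saz) -cv -cv' => /only-> /only->.
Qed.

(** Both [s] and [s'] are initial parts of [p], so by symmetry [s' = s ++ w]. If [w] is empty the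
    relations coincide; if it is one arrow the meshes share an arrow, which is impossible; if it is
    longer the meshes are disjoint. *)
Lemma same_lead_sub r f p : mesh_relations r -> mesh_relations f ->
  lead lt r p -> lead lt f p -> lincomb (relations_below p) (r - f).
Proof.
move=> /mesh_relationsP[s [z [u [t [sz zu ut ->]]]]].
move=> /mesh_relationsP[s' [z' [u' [t' [sz' zu' ut' ->]]]]].
move=> /(lead_mesh_rel (And3 sz zu ut))[a [az pE amax]].
move=> /(lead_mesh_rel (And3 sz' zu' ut'))[b [bz pE' bmax]].
wlog ss' : s z u t sz zu ut a az pE amax s' z' u' t' sz' zu' ut' b bz pE' bmax /
    (size s <= size s')%N.
  move=> wlg; have [ss'|/ltnW s's] := leqP (size s) (size s').
    exact: (wlg s z u t sz zu ut a az pE amax s' z' u' t' sz' zu' ut' b bz pE' bmax ss').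
  rewrite -opprB -scaleN1r; apply: lincombZ.
  exact: (wlg s' z' u' t' sz' zu' ut' b bz pE' bmax s z u t sz zu ut a az pE amax s's).
have [w s'E] : exists w, s' = s ++ w.
  exists (drop (size s) s'); have := congr1 (take (size s)) pE'.
  rewrite pE take_size_cat// take_cat ltn_neqAle ss' andbT.
  case: eqP => /= [->|_ {1}->]; last by rewrite cat_take_drop.
  by rewrite subnn take0 cats0 drop_size cats0.
move: pE'; rewrite s'E pE -catA => /eqP; rewrite eqseq_cat// eqxx /=.
move: sz' bmax; rewrite s'E; case: w {s'E ss'} => [|c [|d w]] /=.
- rewrite cats0 => sz' bmax /eqP[_ _ ->].
  have -> : z' = z.
    have := nth_path_vertices [::] sz'.
    by rewrite (nth_path_vertices [::] sz).
  by rewrite subrr; exact: lincomb0.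
- move=> sz' bmax /eqP[ca bE tE]; exfalso.
  rewrite -{}ca in sz' bmax.
  have z'E : z' = tgt a.
    by move/is_path_catP: sz' => [v _ /= /andP[_ /eqP]].
  rewrite cats1 -bE z'E in bmax.
  apply: (no_adjacent_overlap (p := p) (t := t') sz zu az _ amax _ ut' bmax).
    by rewrite pE tE -bE.
  by rewrite -z'E.
- move=> sz' bmax /eqP[ca dE tE]; subst c d t.
  move/is_path_catP: sz' => [v _ /= /and3P[_ _ uw]].
  rewrite [tgt (sigmaV a)](_ : _ = u) in uw; last first.
    by case: (@sigmaV_ends _ a u); rewrite ?az.
  exact: disjoint_overlap uw zu' ut' az bz pE amax bmax.
Qed.

End MeshLexicographic.

(** * One relation for each leading path, and the spanning property *)

Section StandardRelations.
Variables (k : closedFieldType) (Q : translation_quiver) (x y : vertex Q).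
Variable lt : rel (qpath x y).
Hypothesis closedQ : forall p : qpath x y, closed_path p.
Hypothesis ltM : mesh_lexicographic lt.
Implicit Types (p q : qpath x y) (r f g : kpath k x y).

Let ltT : strict_total_on setT lt. Proof. by case: ltM => la [[]]. Qed.

(** The set given to [xget] depends on [r] only through its leading path, so a single relation is
    chosen for each leading path that occurs. The default 0 never arises, since [r] itself lies in
    that set. *)
Definition standard : set (kpath k x y) :=
  [set r | [/\ mesh_relations r, r != 0
    & r = xget 0 [set f | mesh_relations f /\ lb lt f = lb lt r]]].

Lemma standard_inj r f : standard r -> standard f -> lb lt r = lb lt f -> r = f.
Proof. by move=> [_ _ rE] [_ _ fE] rf; rewrite rE fE rf. Qed.

Lemma standard_exists r : mesh_relations r -> r != 0 ->
  exists2 f, standard f & lb lt f = lb lt r.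
Proof.
move=> rR r0; pose R := [set f : kpath k x y | mesh_relations f /\ lb lt f = lb lt r].
have [fR flb] : mesh_relations (xget 0 R) /\ lb lt (xget 0 R) = lb lt r.
  by apply: (@xgetPex _ 0 R); exists r.
exists (xget 0 R) => //; split=> //; last by rewrite flb.
have [p /(lbP ltT) rp] := lead_exists ltT r0.
move: flb; rewrite rp => /(lbP ltT)[+ _].
by apply: contraTneq => ->; rewrite msupp0 inE.
Qed.

Lemma mesh_relation_size r p q : mesh_relations r ->
  p \in msupp r -> q \in msupp r -> size (arrows p) = size (arrows q).
Proof.
move=> /mesh_relationsP[s [z [_ [t [_ _ _ ->]]]]].
move=> /supp_mesh_relP[a _ ->] /supp_mesh_relP[b _ ->].
by rewrite !size_cat.
Qed.

Lemma count_ltn (T : eqType) (a b : pred T) (e : T) (l : seq T) :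
  subpred a b -> e \in l -> b e -> ~~ a e -> (count a l < count b l)%N.
Proof.
move=> ab + be ae; elim: l => [//|c l IH]; rewrite inE => /predU1P[<-|/IH {}IH] /=.
  by rewrite be (negbTE ae) ltnS; apply: sub_count ab _.
by rewrite -addnS leq_add//; case: (a c) (ab c) => // /(_ isT) ->.
Qed.

Definition standard_of_length m : set (kpath k x y) :=
  [set r | standard r /\ forall p, p \in msupp r -> size (arrows p) = m].

(** Subtracting the standard relation with the same leading path leaves a combination of relations
    of the same length with smaller leading paths. The length is recorded for the sake of the
    Gröbner basis statement. *)
Lemma standard_span m r : mesh_relations r ->
  (forall p, p \in msupp r -> size (arrows p) = m) ->
  lincomb (standard_of_length m) r.
Proof.
move=> rR rm; have [->|r0] := eqVneq r 0; first exact: lincomb0.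
have [p rp] := lead_exists ltT r0.
have [la [laT laM]] := ltM; have [_ tr _] := ltT; have [irr _ _] := ltT.
(* The induction runs on the number of paths of length [m] below the leading path. *)
pose mu p := count (lt^~ p) (paths_between m x y).
have [n] := ubnP (mu p).
elim: n => // n IH in r p rR rm r0 rp *; rewrite ltnS => pn.
have [f fS flb] := standard_exists rR r0.
have {flb} fp : lead lt f p by apply/(lbP ltT); rewrite flb; apply/(lbP ltT).
have [fR f0 _] := fS.
have pm : size (arrows p) = m by apply: rm; case: rp.
have fSm : standard_of_length m f.
  split=> // q qf; rewrite -pm; apply: mesh_relation_size fR qf _.
  by case: fp.
rewrite -(subrK f r); apply: lincombD; last exact: lincomb_mem.
apply: lincomb_trans (same_lead_sub laT closedQ laM rR fR rp fp) => g [gR gp].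
have [->|g0] := eqVneq g 0; first exact: lincomb0.
have [q gq] := lead_exists ltT g0; have [qm qp] := gp q gq.1.
apply: IH gR _ g0 gq _ => [o /gp[->//]|].
(* The count drops strictly: [q] is counted below [p] but not below itself. *)
apply: leq_trans pn; apply: (@count_ltn _ _ _ q) => //.
- by by move=> o /= oq; exact: tr qp.
- by rewrite -pm -qm mem_paths_between.
- exact: irr.
Qed.

(** A nonzero relation is recovered from any one of its paths together with the position of the mesh
    on it, and there are finitely many such pairs in length [m]. *)
Lemma finite_mesh_relations m :
  finite_set (@mesh_relations_of_length k Q x y m).
Proof.
(* The mesh occupies the two arrows of [w] after the first [i]; when fewer than two remain, the
   value is the dummy 0. *)
pose F (w : seq (arrow Q)) (i : nat) : kpath k x y :=
  if drop i w is [:: a, _ & t] then mesh_rel k x y (take i w) (src a) t else 0.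
apply: (@sub_finite_set _ _ [set F w i | w in [set` paths_from m x] & i in `I_m.+1]).
  move=> r [/mesh_relationsP[s [z [u [t [sz zu ut ->]]]]] [r0 rm]].
  have [p [+ _]] := lead_exists ltT r0 => /[dup] /rm pm /supp_mesh_relP[a az pE].
  exists (arrows p); first by rewrite /= -pm; apply: mem_paths_from (qpathP p).
  exists (size s); first by rewrite /= -pm pE size_cat ltnS leq_addr.
  by rewrite /F pE drop_size_cat// take_size_cat// az.
by apply: finite_image2; [exact: finite_seq|exact: finite_II].
Qed.

End StandardRelations.

Theorem theorem4p5 (k : closedFieldType) (Q : translation_quiver)
    (x y : vertex Q) (lt : rel (qpath x y)) :
  (forall p : qpath x y, closed_path p) ->
  mesh_lexicographic lt ->
  (exists S : set (kpath k x y),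
    [/\ S `<=` @mesh_relations k Q x y,
        (forall r, S r -> r != 0),
        (forall r s, S r -> S s -> r <> s -> lb lt r <> lb lt s)
      & forall r, (@mesh_relations k Q x y `\` S) r ->
          linear_combination S r]) /\
  (forall m : nat,
    groebner_basis lt (@mesh_relations_of_length k Q x y m)).
Proof.
move=> closedQ ltM; have ltT : strict_total_on setT lt by case: ltM => la [[]].
have inj (r s : kpath k x y) : standard lt r -> standard lt s -> r <> s -> lb lt r <> lb lt s.
  by move=> rS sS rs /(standard_inj rS sS).
split=> [|m].
  exists (standard lt); split=> //; [by move=> r []|by move=> r []|].
  (* A mesh without arrows gives the relation 0, which is never standard and is the empty
     combination. *)
  move=> r [rR _]; have [->|r0] := eqVneq r 0; first exact: lincomb0.
  have [p [pr _]] := lead_exists ltT r0.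
  apply: (@lincomb_trans _ _ (standard_of_length lt (size (arrows p)))).
    by move=> g [gS _]; exact: lincomb_mem.
  apply: standard_span => // q qr; exact: mesh_relation_size rR qr pr.
split=> [|g [_ [g0 _]] //|f fR f0]; first exact: (finite_mesh_relations k ltM m).
(* Relations of length [m] may share leading paths, so [f] is first rewritten through the standard
   ones. These have distinct leading paths and are themselves relations of length [m]. *)
have fS : lincomb (standard_of_length lt m) f.
  apply: lincomb_trans fR => g [gR [_ gm]].
  exact: (standard_span closedQ ltM gR gm).
have [|g h [gS _] [hS _]|g [gS gm] fg] := lead_linear_combination ltT _ _ fS f0.
- by move=> g [[]].
- exact: inj gS hS.
- by exists g => //; case: gS.
Qed.
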